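(* Let $(\widetilde{Y}^1,\ldots,\widetilde{Y}^{\hat p},\widetilde{U})$ be an optimal solution of the global clique-wise SDP $$ \eta_c=\inf\Big\{\sum_{p=1}^{\hat p}\langle A^p_0,Y^p\rangle :\ U\in\mathbb{S}^n(\overline{D}),\ Y^p\in\mathbb{S}^{C_p}_+\ (p=1,\ldots,\hat p),\ \sum_{p=1}^{\hat p}\langle A^p_k,Y^p\rangle \trianglelefteq_k b_k\ (k=1,\ldots,m),\ [Y^p]_{ij}=[U]_{ij}\ ((i,j)\in D_p,\ p=1,\ldots,\hat p)\Big\}.\qquad (G) $$ For $\delta^p\in\mathbb{R}^m$ and $U\in\mathbb{S}^n(\overline{D})$, consider for each $p=1,\ldots,\hat p$ the local sub-SDP in the variable $Y^p$ $$ \eta^p_c(\delta^p,U)=\inf\Big\{\langle A^p_0,Y^p\rangle :\ Y^p\in\mathbb{S}^{C_p}_+,\ \langle A^p_k,Y^p\rangle\trianglelefteq_k\delta^p_k\ (k=1,\ldots,m),\ [Y^p]_{ij}=[U]_{ij}\ ((i,j)\in D_p)\Big\}.\qquad (L_p) $$ Define $\tilde\delta^p\in\mathbb{R}^m$ by $\tilde\delta^p_k=\langle A^p_k,\widetilde{Y}^p\rangle$ $(k=1,\ldots,m,\ p=1,\ldots,\hat p)$. Then: (i) Each $\widetilde{Y}^p$ is an optimal solution of $(L_p)$ with parameters $(\delta^p,U)=(\tilde\delta^p,\widetilde{U})$; hence $\langle A^p_0,\widetilde{Y}^p\rangle=\eta^p_c(\tilde\delta^p,\widetilde{U})$ $(p=1,\ldots,\hat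 p)$ and $\sum_{p=1}^{\hat p}\eta^p_c(\tilde\delta^p,\widetilde{U})=\sum_{p=1}^{\hat p}\langle A^p_0,\widetilde{Y}^p\rangle=\eta_c$. (ii) For $p=1,\ldots,\hat p$, let $\widehat{Y}^p\in\mathbb{S}^{C_p}_+$ be an optimal solution of $(L_p)$ with parameters $(\delta^p,U)=(\tilde\delta^p,\widetilde{U})$; hence $\langle A^p_0,\widehat{Y}^p\rangle=\eta^p_c(\tilde\delta^p,\widetilde{U})$. Then $(\widehat{Y}^1,\ldots,\widehat{Y}^{\hat p},\widetilde{U})$ is an optimal solution of $(G)$, and therefore $\eta_c=\sum_{p=1}^{\hat p}\langle A^p_0,\widehat{Y}^p\rangle$. (iii) Assume that, for $p=1,\ldots,\hat p$, the sub-SDP $(L_p)$ with parameters $(\delta^p,U)=(\tilde\delta^p,\widetilde{U})$ is exact. Then the SDP $(G)$ is exact.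
   Context: Notation. $\mathbb{S}^n$ is the space of real symmetric $n\times n$ matrices with inner product $\langle A,B\rangle=\sum_{i,j}[A]_{ij}[B]_{ij}$. For a nonempty $C\subseteq N=\{1,\ldots,n\}$, $\mathbb{S}^C$ is the space of real symmetric matrices with rows and columns indexed by $C$ (with the analogous inner product), and $\mathbb{S}^C_+$ is its cone of positive semidefinite matrices. For $X\in\mathbb{S}^n$, $X^C\in\mathbb{S}^C$ is the principal submatrix indexed by $C\times C$. For each $k=1,\ldots,m$, $\trianglelefteq_k$ is a fixed relation, one of $\le$, $=$, $\ge$. Setting. $A_k\in\mathbb{S}^n$ $(k=0,1,\ldots,m)$ and $b\in\mathbb{R}^m$ are given. The aggregate sparsity pattern graph is the undirected graph on $N$ with edges $\{i,j\}$, $i\ne j$, such that $[A_k]_{ij}\neq0$ for some $k\in\{0,\ldots,m\}$. $G(N,E)$ is a chordal extension of it (a chordal graph on $N$ containing all its edges; chordal means every cycle of length at least four has a chord), and $C_1,\ldots,C_{\hat p}$ are the maximal cliques of $G(N,E)$. For each $k=0,\ldots,m$, matrices $A^p_k\in\mathbb{S}^{C_p}$ $(p=1,\ldots,\hat p)$ are fixed such that $[A_k]_{ij}=\sum_{p:\,(i,j)\in C_p\times C_p}[A^p_k]_{ij}$ for every $(i,j)\in\bigcup_p(C_p\times C_p)$; consequently $\langle A_k,X\rangle=\sum_p\langle A_k^p,X^{C_p}\rangle$ for every $X\in\mathbb{S}^n$. Consistency sets: $D_p=\bigcup_{q\ne p}\big((C_p\cap C_q)\times(C_p\cap C_q)\big)$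 and $\overline{D}=\bigcup_{p=1}^{\hat p}D_p$. $\mathbb{S}^n(\overline{D})$ is the set of partial symmetric matrices $U$ whose entries $[U]_{ij}=[U]_{ji}\in\mathbb{R}$ are specified for $(i,j)\in\overline{D}$ (other entries are left unspecified). Exactness. An SDP $(L_p)$ is exact if, whenever it has an optimal solution, it has an optimal solution $Y^p$ with $\mathrm{rank}(Y^p)\le1$. The SDP $(G)$ is exact if, whenever it has an optimal solution, it has an optimal solution $(Y^1,\ldots,Y^{\hat p},U)$ with $\mathrm{rank}(Y^p)\le1$ for all $p=1,\ldots,\hat p$. *)

(* Defs.v *)
From mathcomp Require Import all_boot all_order all_algebra.
From mathcomp Require Import classical_sets reals constructive_ereal ereal.

Set Implicit Arguments.
Unset Strict Implicit.
Unset Printing Implicit Defensive.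

Import Order.TTheory GRing.Theory Num.Theory.
Local Open Scope ring_scope.

Definition is_opt_sol (R : realType) (T : Type) (feas : T -> Prop)
    (obj : T -> R) (x : T) : Prop :=
  feas x /\ forall y, feas y -> obj x <= obj y.

(* Valued in \bar R, so that infeasible and unbounded problems have the values
   +oo and -oo. *)
Definition opt_val (R : realType) (T : Type) (feas : T -> Prop)
    (obj : T -> R) : \bar R :=
  ereal_inf [set (obj x)%:E | x in feas]%classic.

Inductive cmp := CmpLe | CmpEq | CmpGe.

Definition cmp_holds (R : realType) (r : cmp) (x y : R) : Prop :=
  match r with
  | CmpLe => x <= y
  | CmpEq => x = y
  | CmpGe => x >= y
  end.

Definition mxdot (R : realType) (d : nat) (A B : 'M[R]_d) : R :=
  \sum_i \sum_j A i j * B i j.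

Definition psdmx (R : realType) (d : nat) (X : 'M[R]_d) : Prop :=
  X \is symmetricmx /\ forall x : 'cV[R]_d, 0 <= (x^T *m X *m x) 0 0.

(* Matrices with rows and columns indexed by S: the a-th row or column stands
   for the index [enum_val a], the a-th element of S. *)
Notation "''M[' R ]_{ S }" := 'M[R]_#|pred_of_set S|
  (at level 0, format "''M[' R ]_{ S }") : type_scope.

(* The entry of Y at the original indices i, j. At most one pair (a, b)
   contributes (see [entryE]); the value is 0 when i or j is not in S. *)
Definition entry (R : realType) (n : nat) (S : {set 'I_n}) (Y : 'M[R]_{S})
    (i j : 'I_n) : R :=
  \sum_(a | enum_val a == i) \sum_(b | enum_val b == j) Y a b.

Lemma entryE (R : realType) (n : nat) (S : {set 'I_n}) (Y : 'M[R]_{S}) a b :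
  entry Y (enum_val a) (enum_val b) = Y a b.
Proof.
rewrite /entry (big_pred1 a) => [|a']; last by rewrite /= (inj_eq enum_val_inj).
by rewrite (big_pred1 b) // => b'; rewrite /= (inj_eq enum_val_inj).
Qed.

(* Partial symmetric matrices; [None] marks an unspecified entry. *)
Definition partial_sym (R : realType) (n : nat) (D : {set 'I_n * 'I_n})
    (U : 'M[option R]_n) : Prop :=
  U^T = U /\ forall i j, isSome (U i j) = ((i, j) \in D).

Definition sparsity_edge (R : realType) (n m : nat) (A : 'I_m.+1 -> 'M[R]_n) :
    rel 'I_n :=
  fun i j => (i != j) && [exists k, A k i j != 0].

Definition chordal (n : nat) (E : rel 'I_n) : Prop :=
  forall c : seq 'I_n, ucycle E c -> (4 <= size c)%N ->
  exists x y, [/\ x \in c, y \in c, E x y, y != next c x & x != next c y].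

Definition clique (n : nat) (E : rel 'I_n) (S : {set 'I_n}) : bool :=
  [forall i in S, forall j in S, (i != j) ==> E i j].

Definition chordal_extension (n : nat) (E0 E : rel 'I_n) : Prop :=
  [/\ symmetric E, irreflexive E, chordal E & subrel E0 E].

Definition enum_maximal_cliques (n : nat) (E : rel 'I_n) (ph : nat)
    (C : 'I_ph -> {set 'I_n}) : Prop :=
  injective C /\ forall S, maxset (clique E) S <-> exists p, C p = S.

(* Index 0 is the objective, index [lift ord0 k] the constraint k. *)
Definition clique_decomposition (R : realType) (n m ph : nat)
    (C : 'I_ph -> {set 'I_n}) (A : 'I_m.+1 -> 'M[R]_n)
    (Ap : forall p, 'I_m.+1 -> 'M[R]_{C p}) : Prop :=
  (forall p k, Ap p k \is symmetricmx) /\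
  forall k i j, (exists p, i \in C p /\ j \in C p) ->
    A k i j = \sum_(p | (i \in C p) && (j \in C p)) entry (Ap p k) i j.

Definition overlap (n ph : nat) (C : 'I_ph -> {set 'I_n}) (p : 'I_ph) :
    {set 'I_n * 'I_n} :=
  (\bigcup_(q | q != p) finset.setX (C p :&: C q) (C p :&: C q))%SET.

Definition overlaps (n ph : nat) (C : 'I_ph -> {set 'I_n}) :
    {set 'I_n * 'I_n} :=
  (\bigcup_p overlap C p)%SET.

Definition consistent (R : realType) (n ph : nat) (C : 'I_ph -> {set 'I_n})
    (p : 'I_ph) (U : 'M[option R]_n) (Y : 'M[R]_{C p}) : Prop :=
  forall i j, (i, j) \in overlap C p -> U i j = Some (entry Y i j).

Definition global_var (R : realType) (n ph : nat) (C : 'I_ph -> {set 'I_n}) :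
    Type :=
  ((forall p, 'M[R]_{C p}) * 'M[option R]_n)%type.

Definition global_feas (R : realType) (n m ph : nat) (C : 'I_ph -> {set 'I_n})
    (Ap : forall p, 'I_m.+1 -> 'M[R]_{C p}) (rl : 'I_m -> cmp) (b : 'cV[R]_m)
    (z : global_var R C) : Prop :=
  let: (Y, U) := z in
  [/\ partial_sym (overlaps C) U,
      forall p, psdmx (Y p),
      forall k : 'I_m,
        cmp_holds (rl k) (\sum_p mxdot (Ap p (lift ord0 k)) (Y p)) (b k 0)
    & forall p, consistent U (Y p)].

Definition global_obj (R : realType) (n m ph : nat) (C : 'I_ph -> {set 'I_n})
    (Ap : forall p, 'I_m.+1 -> 'M[R]_{C p}) (z : global_var R C) : R :=
  \sum_p mxdot (Ap p ord0) (z.1 p).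

Definition global_opt (R : realType) (n m ph : nat) (C : 'I_ph -> {set 'I_n})
    (Ap : forall p, 'I_m.+1 -> 'M[R]_{C p}) (rl : 'I_m -> cmp) (b : 'cV[R]_m)
    (z : global_var R C) : Prop :=
  is_opt_sol (global_feas Ap rl b) (global_obj Ap) z.

Definition global_val (R : realType) (n m ph : nat) (C : 'I_ph -> {set 'I_n})
    (Ap : forall p, 'I_m.+1 -> 'M[R]_{C p}) (rl : 'I_m -> cmp)
    (b : 'cV[R]_m) : \bar R :=
  opt_val (global_feas Ap rl b) (global_obj Ap).

Definition global_exact (R : realType) (n m ph : nat) (C : 'I_ph -> {set 'I_n})
    (Ap : forall p, 'I_m.+1 -> 'M[R]_{C p}) (rl : 'I_m -> cmp)
    (b : 'cV[R]_m) : Prop :=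
  (exists z, global_opt Ap rl b z) ->
  exists z, global_opt Ap rl b z /\ forall p, (\rank (z.1 p) <= 1)%N.

Definition local_feas (R : realType) (n m ph : nat) (C : 'I_ph -> {set 'I_n})
    (Ap : forall p, 'I_m.+1 -> 'M[R]_{C p}) (rl : 'I_m -> cmp) (p : 'I_ph)
    (delta : 'cV[R]_m) (U : 'M[option R]_n) (Y : 'M[R]_{C p}) : Prop :=
  [/\ psdmx Y,
      forall k : 'I_m,
        cmp_holds (rl k) (mxdot (Ap p (lift ord0 k)) Y) (delta k 0)
    & consistent U Y].

Definition local_opt (R : realType) (n m ph : nat) (C : 'I_ph -> {set 'I_n})
    (Ap : forall p, 'I_m.+1 -> 'M[R]_{C p}) (rl : 'I_m -> cmp) (p : 'I_ph)
    (delta : 'cV[R]_m) (U : 'M[option R]_n) (Y : 'M[R]_{C p}) : Prop :=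
  is_opt_sol (local_feas Ap rl delta U) (mxdot (Ap p ord0)) Y.

Definition local_val (R : realType) (n m ph : nat) (C : 'I_ph -> {set 'I_n})
    (Ap : forall p, 'I_m.+1 -> 'M[R]_{C p}) (rl : 'I_m -> cmp) (p : 'I_ph)
    (delta : 'cV[R]_m) (U : 'M[option R]_n) : \bar R :=
  opt_val (@local_feas R n m ph C Ap rl p delta U) (mxdot (Ap p ord0)).

Definition local_exact (R : realType) (n m ph : nat) (C : 'I_ph -> {set 'I_n})
    (Ap : forall p, 'I_m.+1 -> 'M[R]_{C p}) (rl : 'I_m -> cmp) (p : 'I_ph)
    (delta : 'cV[R]_m) (U : 'M[option R]_n) : Prop :=
  (exists Y : 'M[R]_{C p}, local_opt Ap rl delta U Y) ->
  exists Y : 'M[R]_{C p},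
    local_opt Ap rl delta U Y /\ (\rank Y <= 1)%N.

Definition local_rhs (R : realType) (n m ph : nat) (C : 'I_ph -> {set 'I_n})
    (Ap : forall p, 'I_m.+1 -> 'M[R]_{C p}) (Y : forall p, 'M[R]_{C p})
    (p : 'I_ph) : 'cV[R]_m :=
  \col_k mxdot (Ap p (lift ord0 k)) (Y p).

(* Main.v *)
Require Import Defs.
From mathcomp Require Import all_boot all_order all_algebra.
From mathcomp Require Import boolp classical_sets reals constructive_ereal ereal.

Import Order.TTheory GRing.Theory Num.Theory.
Local Open Scope ring_scope.

Set Implicit Arguments.
Unset Strict Implicit.
Unset Printing Implicit Defensive.

(** Fix the overlap entries [U] of a global optimum, and fix as the right-hand
sides [delta p] of the local problems the values that its blocks give to the
local constraint functionals.  The cliques then decouple: the overlap conditions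
of clique [p] involve [U] and the block [p] only, and the [delta p] add up to
values that satisfy the aggregate constraints.  Hence local feasible points, one
for each clique, glue to a global feasible point with the same [U]
([glue_feas]); for inequality constraints this works because each relation is
preserved by sums and is transitive.

Replacing one block of the global optimum by a local feasible point therefore
gives a global competitor whose objective differs in that block alone, so every
block of a global optimum is a local optimum ([block_opt]).  Conversely, local
optima glue to a global feasible point whose objective is, block by block, at
most that of the global optimum ([glue_opt]).  Exactness is the case in which
the glued blocks have rank at most one. *)

Lemma opt_val_attained (R : realType) (T : Type) (feas : T -> Prop)
    (obj : T -> R) (x : T) :
  is_opt_sol feas obj x -> opt_val feas obj = (obj x)%:E.
Proof.
case=> feas_x min_x; apply/eqP; rewrite eq_le; apply/andP; split.
  by apply: ereal_inf_lbound; exists x.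
by apply: le_ereal_inf_tmp => _ [y feas_y <-]; rewrite lee_fin min_x.
Qed.

Lemma cmp_holds_refl (R : realType) (r : cmp) (x : R) : cmp_holds r x x.
Proof. by case: r => /=. Qed.

Lemma cmp_holds_trans (R : realType) (r : cmp) (x y z : R) :
  cmp_holds r x y -> cmp_holds r y z -> cmp_holds r x z.
Proof.
case: r => /= [xy yz | -> // | xy yz]; first exact: le_trans xy yz.
exact: le_trans yz xy.
Qed.

Lemma cmp_holds_sum (R : realType) (r : cmp) (I : finType) (x y : I -> R) :
  (forall i, cmp_holds r (x i) (y i)) ->
  cmp_holds r (\sum_i x i) (\sum_i y i).
Proof.
case: r => /= xy; [exact: ler_sum | exact: eq_bigr | exact: ler_sum].
Qed.

Section Gluing.

Variables (R : realType) (n m ph : nat) (C : 'I_ph -> {set 'I_n}).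
Variables (Ap : forall p, 'I_m.+1 -> 'M[R]_{C p}).
Variables (rl : 'I_m -> cmp) (b : 'cV[R]_m).
Variables (Yt : forall p, 'M[R]_{C p}) (Ut : 'M[option R]_n).

Let delta := local_rhs Ap Yt.

Lemma block_feas (p : 'I_ph) :
  global_feas Ap rl b (Yt, Ut) -> local_feas Ap rl (delta p) Ut (Yt p).
Proof.
case=> _ psd_Yt _ cons_Yt; split=> // k.
by rewrite mxE; exact: cmp_holds_refl.
Qed.

(** The aggregate constraint [k] follows from the local ones because the
[delta p k] sum to the left-hand side of that constraint at [Yt], which already
stands in the relation [rl k] to [b k]. *)
Lemma glue_feas (Y : forall p, 'M[R]_{C p}) :
  global_feas Ap rl b (Yt, Ut) ->
  (forall p, local_feas Ap rl (delta p) Ut (Y p)) ->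
  global_feas Ap rl b (Y, Ut).
Proof.
case=> sym_Ut _ cstr_Yt _ feas_Y; split=> // [p | k | p].
- by case: (feas_Y p).
- apply: cmp_holds_trans (cstr_Yt k); apply: cmp_holds_sum => p.
  by case: (feas_Y p) => _ /(_ k); rewrite mxE.
- by case: (feas_Y p).
Qed.

(** A local feasible point that improved on [Yt p] would, put in place of the
block [p] only, improve on the global optimum. *)
Lemma block_opt (p : 'I_ph) :
  global_opt Ap rl b (Yt, Ut) -> local_opt Ap rl (delta p) Ut (Yt p).
Proof.
case=> feas_Yt min_Yt; split; first exact: block_feas.
move=> Y feas_Y; pose Z := dfwith Yt Y.
have feas_Z : global_feas Ap rl b (Z, Ut).
  apply: glue_feas => // q; rewrite /Z.
  by case: dfwithP => // r _; exact: block_feas.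
have := min_Yt _ feas_Z; rewrite /global_obj /=.
rewrite (bigD1 p) //= [leRHS](bigD1 p) //= /Z dfwith_in.
(* The objectives agree outside the block p, so those terms cancel. *)
under [X in _ <= _ + X]eq_bigr => q q_neq_p.
  rewrite dfwith_out; last by rewrite eq_sym.
  over.
by rewrite lerD2r.
Qed.

Lemma glue_opt (Y : forall p, 'M[R]_{C p}) :
  global_opt Ap rl b (Yt, Ut) ->
  (forall p, local_opt Ap rl (delta p) Ut (Y p)) ->
  global_opt Ap rl b (Y, Ut).
Proof.
move=> [feas_Yt min_Yt] opt_Y; split.
  by apply: glue_feas => // p; case: (opt_Y p).
move=> z /min_Yt; apply: le_trans; apply: ler_sum => p _.
by case: (opt_Y p) => _; apply; exact: block_feas.
Qed.

Lemma glue_exact :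
  global_opt Ap rl b (Yt, Ut) ->
  (forall p, local_exact Ap rl p (delta p) Ut) ->
  global_exact Ap rl b.
Proof.
move=> opt_Yt exact_p _.
have rank1 p : exists Y : 'M[R]_{C p},
    local_opt Ap rl (delta p) Ut Y /\ (\rank Y <= 1)%N.
  by apply: exact_p; exists (Yt p); exact: block_opt.
pose Y p := sval (cid (rank1 p)).
have [opt_Y rank_Y] : (forall p, local_opt Ap rl (delta p) Ut (Y p)) /\
    forall p, (\rank (Y p) <= 1)%N.
  by split=> p; case: (svalP (cid (rank1 p))).
by exists (Y, Ut); split=> //; exact: glue_opt.
Qed.

End Gluing.

Theorem theorem3p2 (R : realType) (n m ph : nat) (n_gt0 : (0 < n)%N)
    (A : 'I_m.+1 -> 'M[R]_n) (b : 'cV[R]_m) (rl : 'I_m -> cmp)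
    (A_sym : forall k, A k \is symmetricmx)
    (E : rel 'I_n) (E_ext : chordal_extension (sparsity_edge A) E)
    (C : 'I_ph -> {set 'I_n}) (C_max : enum_maximal_cliques E C)
    (Ap : forall p : 'I_ph, 'I_m.+1 -> 'M[R]_{C p})
    (Ap_dec : clique_decomposition A Ap)
    (Yt : forall p : 'I_ph, 'M[R]_{C p}) (Ut : 'M[option R]_n)
    (YUt_opt : global_opt Ap rl b (Yt, Ut)) :
  let delta := local_rhs Ap Yt in
  [/\ [/\ forall p : 'I_ph, local_opt Ap rl (delta p) Ut (Yt p),
          forall p : 'I_ph,
            (mxdot (Ap p ord0) (Yt p))%:E = local_val Ap rl p (delta p) Ut,
          (\sum_(p < ph) local_val Ap rl p (delta p) Ut)%E =
            (\sum_(p < ph) mxdot (Ap p ord0) (Yt p))%:E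
        & (\sum_(p < ph) mxdot (Ap p ord0) (Yt p))%:E = global_val Ap rl b],
      forall Yh : forall p : 'I_ph, 'M[R]_{C p},
        (forall p : 'I_ph, local_opt Ap rl (delta p) Ut (Yh p)) ->
        [/\ forall p : 'I_ph,
              (mxdot (Ap p ord0) (Yh p))%:E = local_val Ap rl p (delta p) Ut,
            global_opt Ap rl b (Yh, Ut)
          & global_val Ap rl b = (\sum_(p < ph) mxdot (Ap p ord0) (Yh p))%:E]
    & (forall p : 'I_ph, local_exact Ap rl p (delta p) Ut) ->
        global_exact Ap rl b].
Proof.
move=> delta; have opt_Yt p := block_opt p YUt_opt.
split; [split=> // | move=> Yh opt_Yh | exact: glue_exact YUt_opt].
- by move=> p; rewrite /local_val (opt_val_attained (opt_Yt p)).
- by rewrite -sumEFin; apply: eq_bigr => p _; exact: opt_val_attained (opt_Yt p).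
- by rewrite /global_val (opt_val_attained YUt_opt).
- have opt_YhU := glue_opt YUt_opt opt_Yh.
  split=> // [p|]; first by rewrite /local_val (opt_val_attained (opt_Yh p)).
  by rewrite /global_val (opt_val_attained opt_YhU).
Qed.
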